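(* Let $1\leqslant m<n$ be integers and $$F_{m,n}(x,y,z,t)=\left|\begin{array}{cccc}1 & x & x^m & x^n \\ 1 & y & y^m & y^n \\ 1 & z & z^m & z^n \\ 1 & t & t^m & t^n\end{array}\right|.$$ Then $$F_{m,n}(x,y,z,t)=(y-x)(z-x)(t-x)(z-y)(t-y)(t-z)\sum_{j=0}^{m-2}\sum_{k=0}^{n-m-1}x^{n-3-j-k}\sum_{r=0}^{j}\sum_{s=j+1}^{m+k-1}y^{m+j+k-r-s-1}z^rt^r\sigma_{s-r-1}(z,t).$$
   Context: For a non-negative integer $k$, $\sigma_k(x,y):=\sum_{i=0}^{k}x^{k-i}y^i$. Here $x,y,z,t$ are indeterminates (the formula is a polynomial identity), and empty sums are equal to $0$. *)

(* Defs.v *)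
From mathcomp Require Import all_boot all_algebra.

Set Implicit Arguments.
Unset Strict Implicit.
Unset Printing Implicit Defensive.

Import GRing.Theory.
Local Open Scope ring_scope.

(* Polynomial identities with integer coefficients are stated for arbitrary
   elements of an arbitrary commutative ring; taking the variables of a
   polynomial ring gives the identity between indeterminates. *)

Definition sigma (R : comNzRingType) (k : nat) (x y : R) : R :=
  \sum_(0 <= i < k.+1) x ^+ (k - i) * y ^+ i.

Definition F (R : comNzRingType) (m n : nat) (x y z t : R) : R :=
  \det (\matrix_(i < 4, j < 4)
    (nth [::] [:: [:: 1; x; x ^+ m; x ^+ n];
                  [:: 1; y; y ^+ m; y ^+ n];
                  [:: 1; z; z ^+ m; z ^+ n];
                  [:: 1; t; t ^+ m; t ^+ n]] i)`_j).

(* Main.v *)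
Require Import Defs.
From mathcomp Require Import all_boot all_algebra.
From mathcomp Require Import ring zify.

Import GRing.Theory.
Local Open Scope ring_scope.

(** Both the four-row determinant and the three-row determinants
    [det (1, u^a, u^b)] with [u] in [{y, z, t}] are reduced by the same step.
    Subtracting the first row removes the column of ones, and each new row is
    divisible by a linear factor because
    [u^(p+1) - v^(p+1) = (u - v) * sigma p v u] ([subXX_sigma]).  The cofactor
    is a determinant whose last two columns are [sigma p v u] and
    [sigma q v u].  Expanding both sums bilinearly writes it as a double sum,
    over [i <= p] and [l <= q], of [v^(p+q-i-l)] times a smaller determinant
    with exponents [i] and [l].  That smaller determinant is alternating in
    [(i, l)] while the weight is symmetric, so the square [i, l <= p] adds up
    to zero and only [p < l <= q] survives ([sum_weighted_alternating]).

    The first reduction, with [v = x], [p = m - 1] and [q = n - 1], leaves the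
    three-row determinants with exponents [i = j + 1] and [l = m + k], the term
    [i = 0] having two equal columns.  The second, with [v = y], leaves the
    two-row determinants [z^r t^s - z^s t^r], which factor as
    [(t - z) (z t)^r sigma (s-r-1) z t].  The six linear factors extracted on
    the way form the Vandermonde product. *)

Lemma subXX_sigma (R : comNzRingType) (p : nat) (u v : R) :
  u ^+ p.+1 - v ^+ p.+1 = (u - v) * sigma p v u.
Proof.
by rewrite /sigma -opprB subrXX big_mkord -mulNr opprB.
Qed.

(** Only terms of positive degree in the second variable distinguish two
    values of [sigma]; this is the row subtraction that follows the extraction
    of the linear factors. *)
Lemma sigma_subr (R : comNzRingType) (p : nat) (x u v : R) :
  sigma p x u - sigma p x v =
  \sum_(0 <= i < p.+1) x ^+ (p - i) * (u ^+ i - v ^+ i).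
Proof. by rewrite /sigma -sumrB; apply: eq_bigr => i _; rewrite mulrBr. Qed.

(** The vanishing diagonal is assumed separately since [V] may have
    [2]-torsion. *)
Lemma sum_alternating_square (V : zmodType) (f : nat -> nat -> V) (a : nat) :
  (forall i, f i i = 0) -> (forall i l, f i l = - f l i) ->
  \sum_(0 <= i < a) \sum_(0 <= l < a) f i l = 0.
Proof.
move=> f_diag f_anti; elim: a => [|a IHa]; first by rewrite big_geq.
rewrite big_nat_recr //= big_nat_recr //= f_diag addr0.
under eq_bigr do rewrite big_nat_recr //=.
rewrite big_split /= IHa add0r -big_split /=.
by rewrite big1 // => i _; rewrite f_anti addNr.
Qed.

(** The weight [x^(p-i) x^(q-l)] depends on [i + l] only, so it preserves the
    alternation of [G], and the square part of the sum cancels. *)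
Lemma sum_weighted_alternating (R : comNzRingType) (G : nat -> nat -> R)
    (x : R) (p q : nat) :
  (forall i, G i i = 0) -> (forall i l, G i l = - G l i) -> (p <= q)%N ->
  \sum_(0 <= i < p.+1) \sum_(0 <= l < q.+1) x ^+ (p - i) * x ^+ (q - l) * G i l
  = \sum_(0 <= i < p.+1) \sum_(p.+1 <= l < q.+1) x ^+ (p + q - (i + l)) * G i l.
Proof.
move=> G_diag G_anti le_pq.
pose f i l := x ^+ (p + q - (i + l)) * G i l.
transitivity (\sum_(0 <= i < p.+1) \sum_(0 <= l < q.+1) f i l).
  apply: eq_big_nat => i ltip; apply: eq_big_nat => l ltlq.
  by rewrite /f -exprD; congr (_ ^+ _ * _); lia.
under eq_bigr do rewrite (big_cat_nat (n := p.+1)) //=.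
rewrite big_split /= sum_alternating_square ?add0r // /f.
  by move=> i; rewrite G_diag mulr0.
by move=> i l; rewrite G_anti mulrN (addnC i).
Qed.

(** The determinant with rows [(1, y^a, y^b)], [(1, z^a, z^b)] and
    [(1, t^a, t^b)], after subtraction of the first row. *)
Definition alternant3 {R : comNzRingType} (y z t : R) (a b : nat) : R :=
  (z ^+ a - y ^+ a) * (t ^+ b - y ^+ b) - (t ^+ a - y ^+ a) * (z ^+ b - y ^+ b).

Lemma alternant2_factor (R : comNzRingType) (z t : R) (r s : nat) :
  (r < s)%N ->
  z ^+ r * t ^+ s - z ^+ s * t ^+ r =
  (t - z) * (z ^+ r * t ^+ r * sigma (s - r - 1) z t).
Proof.
move=> lt_rs; have -> : s = (r + (s - r - 1).+1)%N by lia.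
set d := (s - r - 1)%N; have -> : (r + d.+1 - r - 1 = d)%N by lia.
rewrite !(exprD _ r) [RHS]mulrCA -subXX_sigma; ring.
Qed.

(** The reduction step with pivot [y], applied to rows [z] and [t]. *)
Lemma alternant3_factor (R : comNzRingType) (y z t : R) (p q : nat) :
  (p <= q)%N ->
  alternant3 y z t p.+1 q.+1 =
  (z - y) * (t - y) * (t - z) *
  \sum_(0 <= r < p.+1) \sum_(p.+1 <= s < q.+1)
    y ^+ (p + q - (r + s)) * (z ^+ r * t ^+ r * sigma (s - r - 1) z t).
Proof.
move=> le_pq; rewrite /alternant3 !subXX_sigma.
have -> : (z - y) * sigma p y z * ((t - y) * sigma q y t) -
          (t - y) * sigma p y t * ((z - y) * sigma q y z) =
  (z - y) * (t - y) * (sigma p y z * sigma q y t - sigma p y t * sigma q y z).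
  ring.
rewrite -[RHS]mulrA; congr (_ * _).
pose G r s := z ^+ r * t ^+ s - z ^+ s * t ^+ r.
transitivity (\sum_(0 <= r < p.+1) \sum_(0 <= s < q.+1)
                y ^+ (p - r) * y ^+ (q - s) * G r s).
  rewrite /sigma !big_distrl /= -sumrB; apply: eq_bigr => r _.
  rewrite !big_distrr /= -sumrB; apply: eq_bigr => s _.
  rewrite /G; ring.
rewrite sum_weighted_alternating // /G; first last.
- by move=> r s; rewrite opprB.
- by move=> r; rewrite subrr.
rewrite big_distrr; apply: eq_big_nat => r ltrp.
rewrite big_distrr; apply: eq_big_nat => s /andP[ltps _] /=.
by rewrite alternant2_factor 1?mulrCA //; lia.
Qed.

(** Abstracting the entries as a function of two natural numbers gives the
    minors of a determinant the same form as the determinant itself. *)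
Definition det_of_entries {R : comNzRingType} (k : nat) (f : nat -> nat -> R) :=
  \det (\matrix_(i < k, j < k) f i j).

Lemma det_of_entries_recl (R : comNzRingType) (k : nat) (f : nat -> nat -> R) :
  det_of_entries k.+1 f =
  \sum_(0 <= j < k.+1)
    f 0%N j * ((-1) ^+ j * det_of_entries k (fun i l => f i.+1 (bump j l))).
Proof.
rewrite big_mkord /det_of_entries (expand_det_row _ ord0).
apply: eq_bigr => j _; rewrite mxE /cofactor add0n.
congr (_ * (_ * \det _)).
by apply/matrixP => i l; rewrite !mxE.
Qed.

Lemma F_row_reduced (R : comNzRingType) (m n : nat) (x y z t : R) :
  F m n x y z t =
  (y - x) * ((z ^+ m - x ^+ m) * (t ^+ n - x ^+ n)
             - (t ^+ m - x ^+ m) * (z ^+ n - x ^+ n))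
  - (z - x) * ((y ^+ m - x ^+ m) * (t ^+ n - x ^+ n)
               - (t ^+ m - x ^+ m) * (y ^+ n - x ^+ n))
  + (t - x) * ((y ^+ m - x ^+ m) * (z ^+ n - x ^+ n)
               - (z ^+ m - x ^+ m) * (y ^+ n - x ^+ n)).
Proof.
pose entry i j := (nth [::] [:: [:: 1; x; x ^+ m; x ^+ n];
                                [:: 1; y; y ^+ m; y ^+ n];
                                [:: 1; z; z ^+ m; z ^+ n];
                                [:: 1; t; t ^+ m; t ^+ n]] i)`_j.
rewrite -[F _ _ _ _ _ _]/(det_of_entries 4 entry).
do 4! rewrite !det_of_entries_recl /index_iota /= !big_cons !big_nil.
rewrite /det_of_entries !det_mx00 /entry /=.
ring.
Qed.

(** The reduction step with pivot [x], applied to rows [y], [z] and [t]; the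
    combination of [sigma] values obtained is again reduced by its first row,
    which produces the three-row determinants. *)
Lemma F_factor (R : comNzRingType) (p q : nat) (x y z t : R) :
  (p <= q)%N ->
  F p.+1 q.+1 x y z t =
  (y - x) * (z - x) * (t - x) *
  \sum_(0 <= i < p.+1) \sum_(p.+1 <= l < q.+1)
    x ^+ (p + q - (i + l)) * alternant3 y z t i l.
Proof.
move=> le_pq; rewrite F_row_reduced !subXX_sigma.
rewrite -sum_weighted_alternating //; first last.
- by move=> i l; rewrite /alternant3; ring.
- by move=> i; rewrite /alternant3; ring.
transitivity ((y - x) * (z - x) * (t - x) *
  ((sigma p x z - sigma p x y) * (sigma q x t - sigma q x y)
   - (sigma p x t - sigma p x y) * (sigma q x z - sigma q x y))).
  ring.
congr (_ * _); rewrite !sigma_subr !big_distrl /= -sumrB.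
apply: eq_bigr => i _; rewrite !big_distrr /= -sumrB.
by apply: eq_bigr => l _; rewrite /alternant3; ring.
Qed.

Theorem theorem3p3 (R : comNzRingType) (m n : nat)
    (hm : (1 <= m)%N) (hmn : (m < n)%N) (x y z t : R) :
  F m n x y z t =
  (y - x) * (z - x) * (t - x) * (z - y) * (t - y) * (t - z) *
  \sum_(0 <= j < m - 1) \sum_(0 <= k < n - m)
    (x ^+ (n - 3 - j - k) *
     \sum_(0 <= r < j.+1) \sum_(j.+1 <= s < m + k)
       (y ^+ (m + j + k - r - s - 1) * z ^+ r * t ^+ r *
        sigma (s - r - 1) z t)).
Proof.
case: m hm hmn => // p _; case: n => // q; rewrite ltnS => lt_pq.
rewrite F_factor 1?ltnW // !subn1 /= big_nat_recl //=.
(* The index i = 0 gives two equal columns of ones. *)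
rewrite [X in _ * (X + _)]big1 ?add0r; last first.
  by move=> l _; rewrite /alternant3 !expr0 !subrr !mul0r subrr mulr0.
rewrite -!mulrA; do 3! congr (_ * _); rewrite !mulrA.
rewrite big_distrr; apply: eq_big_nat => j /andP[_ ltjp] /=.
rewrite -{1}[p.+1]add0n big_addn big_distrr.
apply: eq_big_nat => k /andP[_ ltk] /=.
rewrite addnS alternant3_factor; last by lia.
rewrite mulrCA; congr (_ * (_ ^+ _ * _)); first by lia.
apply: eq_big_nat => r /andP[_ ltrj].
rewrite addSn (addnC p); apply: eq_big_nat => s /andP[ltjs lts].
by rewrite !mulrA; congr (_ ^+ _ * _ * _ * _); lia.
Qed.
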